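(* Let $n\ge 3$, let $(\mathfrak g,[\cdot,\cdot],\alpha)$ be a multiplicative Hom-Lie superalgebra over $\mathbb K$, and let $\phi\in\wedge^{n-2}\mathfrak g^*$ be even and satisfy $$\phi\wedge\delta\phi_X=0\ \text{ for all } X=(x_1,\dots,x_{n-3})\in\mathcal H(\mathfrak g)^{n-3},\qquad \phi\circ(\alpha\otimes\mathrm{Id}\otimes\dots\otimes\mathrm{Id})=\phi .$$ Let $\mathfrak D$ be a homogeneous $\alpha^k$-derivation of $(\mathfrak g,[\cdot,\cdot],\alpha)$ such that $$\sum_{i=1}^{n-2}(-1)^{|\mathfrak D||X|^{i-1}}\phi(x_1,\dots,\mathfrak D(x_i),\dots,x_{n-2})=0\qquad\text{for all }x_1,\dots,x_{n-2}\in\mathcal H(\mathfrak g),$$ where $|X|^{i-1}=\sum_{l=1}^{i-1}|x_l|$. Then $\mathfrak D$ is an $\alpha^k$-derivation of the $n$-Hom-Lie superalgebra $(\mathfrak g,[\cdot,\dots,\cdot]_\phi,\alpha)$.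
   Context: $\mathbb K$ is an algebraically closed field of characteristic zero. For a $\mathbb Z_2$-graded linear space $V=V_{\overline 0}\oplus V_{\overline 1}$, $\mathcal H(V)=V_{\overline 0}\cup V_{\overline 1}$ and $|v|\in\mathbb Z_2$ is the degree of $v\in\mathcal H(V)$; a homogeneous endomorphism $\mathfrak D$ has degree $|\mathfrak D|$. A map is even if it preserves total degree ($\mathbb K$ being in degree $\overline 0$). A Hom-Lie superalgebra $(\mathfrak g,[\cdot,\cdot],\alpha)$ is a $\mathbb Z_2$-graded linear space with an even bilinear map $[\cdot,\cdot]$ and an even linear map $\alpha:\mathfrak g\to\mathfrak g$ such that for homogeneous $x,y,z$: $[x,y]=-(-1)^{|x||y|}[y,x]$ and $(-1)^{|x||z|}[\alpha(x),[y,z]]+(-1)^{|y||x|}[\alpha(y),[z,x]]+(-1)^{|z||y|}[\alpha(z),[x,y]]=0$. It is multiplicative if $\alpha([x,y])=[\alpha(x),\alpha(y)]$. $\wedge^{k}\mathfrak g^*$ is the space of super-skew-symmetric $k$-linear forms on $\mathfrak g$ (interchanging adjacent homogeneous arguments $x_i,x_{i+1}$ multiplies the value by $-(-1)^{|x_i||x_{i+1}|}$). A hat denotes omission. Put $\gamma^X_{ij}=(|x_{j+1}|+\dots+|x_n|)(|x_i|+|x_j|)+|x_i|(|x_{i+1}|+\dots+|x_{j-1}|)$, and similarly $\gamma^Y_{ij}$ for $y_1,\dots,y_n$. The $n$-ary product is $$[x_1,\dots,x_n]_\phi=\sum_{i<j}(-1)^{i+j+1}(-1)^{\gamma^X_{ij}}\phi(x_1,\dots,\widehat{x_i},\dots,\widehat{x_j},\dots,x_n)[x_i,x_j]$$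 on homogeneous elements, extended multilinearly. For $X=(x_1,\dots,x_{n-3})$, $\phi_X(z)=\phi(x_1,\dots,x_{n-3},z)$ and $$\phi\wedge\delta\phi_X(y_1,\dots,y_n)=\sum_{i<j}(-1)^{i+j}(-1)^{\gamma^Y_{ij}}\phi(y_1,\dots,\widehat{y_i},\dots,\widehat{y_j},\dots,y_n)\phi_X([y_i,y_j]).$$ For a $\mathbb Z_2$-graded space $\mathcal N$ with an even $m$-linear bracket and an even linear map $\alpha$, and an integer $k\ge 0$, a homogeneous $\mathfrak D\in \mathrm{End}(\mathcal N)$ is an $\alpha^k$-derivation of $(\mathcal N,[\cdot,\dots,\cdot],\alpha)$ if $\mathfrak D\circ\alpha=\alpha\circ\mathfrak D$ and, for all homogeneous $x_1,\dots,x_m$, $$\mathfrak D[x_1,\dots,x_m]=\sum_{i=1}^m(-1)^{|\mathfrak D||X|^{i-1}}[\alpha^k(x_1),\dots,\alpha^k(x_{i-1}),\mathfrak D(x_i),\alpha^k(x_{i+1}),\dots,\alpha^k(x_m)],$$ with $|X|^{i-1}=\sum_{l<i}|x_l|$; $\alpha^k$ is the $k$-fold composition and $\alpha^0=\mathrm{Id}$. (The case $m=2$ is used for the Hom-Lie superalgebra, $m=n$ for $[\cdot,\dots,\cdot]_\phi$.) *)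

(* Defs.v *)
From HB Require Import structures.
From mathcomp Require Import all_boot all_fingroup all_algebra.

Set Implicit Arguments.
Unset Strict Implicit.
Unset Printing Implicit Defensive.

Import GRing.Theory.
Local Open Scope ring_scope.

(* V = V_0 (+) V_1.  The projections are determined by the two subspaces; they
   are recorded so that no choice principle is needed to decompose a vector. *)
Record z2grading (K : fieldType) (V : lmodType K) := Z2Grading {
  part : 'Z_2 -> submodClosed V;
  proj : 'Z_2 -> V -> V;
  proj_part : forall a v, proj a v \in part a;
  proj_sum : forall v, v = proj 0 v + proj 1 v;
  part_direct : forall v, v \in part 0 -> v \in part 1 -> v = 0
}.

Section Graded.
Variables (K : fieldType) (V : lmodType K) (gr : z2grading V).

(* The degree of a homogeneous vector is always passed explicitly, since the
   zero vector has both degrees.  In exponents of -1, elements of 'Z_2 are read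
   as the natural numbers 0 and 1, and only the parity matters. *)
Definition homogeneous_tuple m (d : {ffun 'I_m -> 'Z_2})
    (x : {ffun 'I_m -> V}) : Prop :=
  forall i, x i \in part gr (d i).

Definition homogeneous_map (e : 'Z_2) (f : V -> V) : Prop :=
  forall a v, v \in part gr a -> f v \in part gr (e + a).

Definition even_map (f : V -> V) : Prop := homogeneous_map 0 f.

Definition multilinear m (W : lmodType K) (f : {ffun 'I_m -> V} -> W) : Prop :=
  forall (i : 'I_m) (x : {ffun 'I_m -> V}),
    linear (fun v : V => f [ffun l => if l == i then v else x l]).

Definition super_skew m (f : {ffun 'I_m -> V} -> K^o) : Prop :=
  forall (i j : 'I_m) d x, j = i.+1 :> nat -> homogeneous_tuple d x ->
    f [ffun l => x (tperm i j l)] = - (-1) ^+ (d i * d j)%N * f x.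

(* phi belongs to the m-th super-exterior power of the dual of V. *)
Definition wedge_form m (phi : {ffun 'I_m -> V} -> K^o) : Prop :=
  multilinear phi /\ super_skew phi.

(* K sits in degree 0, so an even form vanishes in odd total degree. *)
Definition even_form m (phi : {ffun 'I_m -> V} -> K^o) : Prop :=
  forall d x, homogeneous_tuple d x -> \sum_i d i != 0 -> phi x = 0.

Record hom_lie_superalgebra (br : {bilinear V -> V -> V})
    (alpha : {linear V -> V}) : Prop := HomLieSuperalgebra {
  hls_even_bracket : forall a b x y,
    x \in part gr a -> y \in part gr b -> br x y \in part gr (a + b);
  hls_even_twist : even_map alpha;
  hls_skew : forall a b x y, x \in part gr a -> y \in part gr b ->
    br x y = - (-1) ^+ (a * b)%N *: br y x;
  hls_jacobi : forall a b c x y z,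
    x \in part gr a -> y \in part gr b -> z \in part gr c ->
      (-1) ^+ (a * c)%N *: br (alpha x) (br y z)
    + (-1) ^+ (b * a)%N *: br (alpha y) (br z x)
    + (-1) ^+ (c * b)%N *: br (alpha z) (br x y) = 0
}.

Definition hom_multiplicative (br : {bilinear V -> V -> V})
    (alpha : {linear V -> V}) : Prop :=
  forall x y, alpha (br x y) = br (alpha x) (alpha y).

Definition binary (br : {bilinear V -> V -> V}) (x : {ffun 'I_2 -> V}) : V :=
  br (x ord0) (x ord_max).

Definition alpha_derivation m (br : {ffun 'I_m -> V} -> V) (alpha : {linear V -> V})
    (k : nat) (e : 'Z_2) (D : {linear V -> V}) : Prop :=
  [/\ homogeneous_map e D,
      forall v, D (alpha v) = alpha (D v)
    & forall d x, homogeneous_tuple d x ->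
        D (br x) =
        \sum_(i < m) (-1) ^+ (e * \sum_(l < m | (l < i)%N) d l)%N *:
          br [ffun l => if l == i then D (x l) else iter k alpha (x l)]].

Section NaryProduct.
Variables (n : nat) (br : {bilinear V -> V -> V}).
Variable phi : {ffun 'I_(n - 2) -> V} -> K^o.

Fact omit_subproof (i j : 'I_n) (l : 'I_(n - 2)) : (bump j (bump i l) < n)%N.
Proof.
case: l => l /=; rewrite ltn_subRL => hl; rewrite /bump.
apply: leq_ltn_trans hl; rewrite addnA leq_add2r.
by rewrite (leq_add (leq_b1 _) (leq_b1 _)).
Qed.

(* For i < j, the increasing enumeration of the indices other than i and j. *)
Definition omit_index (i j : 'I_n) (l : 'I_(n - 2)) : 'I_n :=
  Ordinal (omit_subproof i j l).

Definition omit (i j : 'I_n) (x : {ffun 'I_n -> V}) : {ffun 'I_(n - 2) -> V} :=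
  [ffun l => x (omit_index i j l)].

Definition gamma (d : {ffun 'I_n -> 'Z_2}) (i j : 'I_n) : nat :=
  ((\sum_(l < n | (j < l)%N) d l) * (d i + d j)
   + d i * \sum_(l < n | (i < l < j)%N) d l)%N.

(* The indices i, j start at 0 here, hence the parity of i + j + 1 and i + j
   is the same as for indices starting at 1. *)
Definition nary_product_homog (d : {ffun 'I_n -> 'Z_2})
    (x : {ffun 'I_n -> V}) : V :=
  \sum_(i < n) \sum_(j < n | (i < j)%N)
    ((-1) ^+ (i + j + 1)%N * (-1) ^+ gamma d i j * phi (omit i j x))
      *: br (x i) (x j).

(* Multilinear extension: sum over the homogeneous components of the
   arguments. *)
Definition nary_product (x : {ffun 'I_n -> V}) : V :=
  \sum_(d : {ffun 'I_n -> 'Z_2})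
    nary_product_homog d [ffun l => proj gr (d l) (x l)].

Definition partial_form (X : {ffun 'I_(n - 3) -> V}) (z : V) : K :=
  phi [ffun l : 'I_(n - 2) => oapp X z (insub (val l))].

Definition wedge_delta (X : {ffun 'I_(n - 3) -> V})
    (d : {ffun 'I_n -> 'Z_2}) (y : {ffun 'I_n -> V}) : K :=
  \sum_(i < n) \sum_(j < n | (i < j)%N)
    (-1) ^+ (i + j)%N * (-1) ^+ gamma d i j * phi (omit i j y)
      * partial_form X (br (y i) (y j)).

End NaryProduct.

End Graded.

(* Main.v *)
Require Import Defs.
From HB Require Import structures.
From mathcomp Require Import all_boot all_fingroup all_algebra.
From mathcomp Require Import zify.

Set Implicit Arguments.
Unset Strict Implicit.
Unset Printing Implicit Defensive.

Import GRing.Theory.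
Local Open Scope ring_scope.

(** On homogeneous arguments of degrees [d], both sides of the Leibniz rule
    for the n-ary product are sums over pairs i < j: the left side of
    D [x_i, x_j], the right side of products of two arguments among which, for
    some position p, the p-th is D x_p and all the others are alpha^k x_l.  So
    it suffices to fix i < j and to sum over p.

    - When p is i or j, the form only sees arguments alpha^k x_l.  Since [phi]
      is invariant under alpha in its first argument, super-skew-symmetry makes
      it invariant under alpha in every argument ([form_twist]), so the
      coefficient is phi(.., x_i omitted, .., x_j omitted, ..) up to a sign.
      The two terms then add up to the Leibniz rule for D [x_i, x_j].
    - When p is neither i nor j, the bracket is [alpha^k x_i, alpha^k x_j]
      whatever p is, and invariance under alpha turns the sum of the
      coefficients into the sum over all positions of phi(.., D x_p, ..),
      which vanishes by the assumption on D ([leibniz_coef_omit]).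

    Replacing x_p by D x_p shifts the p-th degree by e, which changes the Koszul
    sign gamma.  Together with the sign e (d_1 + .. + d_(p-1)) of the Leibniz
    rule this leaves exactly the sign that each case needs, up to the factor
    (-1)^(e s) in the first case, s being the total degree of the arguments of
    [phi]; and [phi], being even, vanishes unless s is even
    ([sign_form_omit]).

    The hypothesis on D is phrased on 'I_(n - 2), and the sum over p on 'I_n;
    [reindex_omit] translates between them. *)

(** * Signs and parities *)

(** Signs are compared through the parity of their exponents: the degrees are
    residues modulo 2 added once in 'Z_2 and once as natural numbers, and only
    the parities of the two sums agree. *)
Lemma eq_signr (R : pzRingType) (m p : nat) :
  odd m = odd p -> (-1) ^+ m = (-1) ^+ p :> R.
Proof. by move=> eq_mp; rewrite -signr_odd eq_mp signr_odd. Qed.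

Lemma odd_Z2D (a b : 'Z_2) : odd (a + b)%R = odd a (+) odd b.
Proof. by rewrite /= odd_mod // oddD. Qed.

Lemma odd_sum_Z2 (I : finType) (P : pred I) (d : I -> 'Z_2) :
  odd (\sum_(l | P l) d l)%R = odd (\sum_(l | P l) d l)%N.
Proof.
rewrite (big_morph (fun a : 'Z_2 => odd a) odd_Z2D
           (erefl : odd (0%R : 'Z_2) = false)).
by rewrite (big_morph odd oddD (erefl : odd 0%N = false)).
Qed.

Definition shift_degree (m : nat) (e : 'Z_2) (p : 'I_m)
    (d : {ffun 'I_m -> 'Z_2}) : {ffun 'I_m -> 'Z_2} :=
  [ffun l => if l == p then e + d l else d l].

Lemma odd_shift_degree m e (p : 'I_m) d l :
  odd (shift_degree e p d l) = odd (d l) (+) ((l == p) && odd e).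
Proof.
by rewrite ffunE; case: eqP => _; rewrite ?odd_Z2D ?addbF // addbC.
Qed.

Lemma odd_sum_shift_degree m e (p : 'I_m) d (P : pred 'I_m) :
  odd (\sum_(l | P l) shift_degree e p d l)%N
  = odd (\sum_(l | P l) d l)%N (+) (P p && odd e).
Proof.
rewrite !(big_morph odd oddD (erefl : odd 0%N = false)).
under eq_bigr do rewrite odd_shift_degree.
rewrite big_split /=; congr (_ (+) _).
rewrite big_mkcond (bigD1 p) //= big1 ?eqxx ?addbF; first by case: (P p).
by move=> l /negPf ->; case: (P l).
Qed.

Lemma odd_gamma_shift n (d : {ffun 'I_n -> 'Z_2}) e p i j :
  odd (gamma (shift_degree e p d) i j)
  = ((odd (\sum_(l < n | (j < l)%N) d l)%N (+) ((j < p)%N && odd e))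
       && ((odd (d i) (+) ((i == p) && odd e))
             (+) (odd (d j) (+) ((j == p) && odd e))))
    (+) ((odd (d i) (+) ((i == p) && odd e))
         && (odd (\sum_(l < n | (i < l < j)%N) d l)%N
               (+) ((i < p < j)%N && odd e))).
Proof.
by rewrite /gamma oddD !oddM oddD !odd_sum_shift_degree !odd_shift_degree.
Qed.

(** * Omitting two indices and the resulting signs *)

Section Omit.
Variables (n : nat) (i j : 'I_n).
Hypothesis lt_ij : (i < j)%N.

Lemma omit_index_neq l : (omit_index i j l != i) && (omit_index i j l != j).
Proof. by rewrite -!val_eqE /= /bump; lia. Qed.

Lemma omit_index_mono (l l' : 'I_(n - 2)) :
  (omit_index i j l < omit_index i j l')%N = (l < l')%N.
Proof. by rewrite /= /bump; lia. Qed.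

Lemma omit_index_inj : injective (omit_index i j).
Proof.
move=> l l' /(congr1 val) /= eq_ll'; apply: val_inj; move: eq_ll'.
by rewrite /bump /=; lia.
Qed.

Lemma omit_index_surj p :
  p != i -> p != j -> exists q, omit_index i j q = p.
Proof.
rewrite -!val_eqE => neq_pi neq_pj.
have lt_p : (unbump i (unbump j p) < n - 2)%N.
  by case: p neq_pi neq_pj => p ltpn /=; rewrite /unbump; have := ltn_ord j; lia.
exists (Ordinal lt_p); apply: val_inj; move: neq_pi neq_pj => /=.
by rewrite /bump /unbump; lia.
Qed.

Lemma reindex_omit (R : Type) (idx : R) (op : Monoid.com_law idx)
    (P : pred 'I_n) (F : 'I_n -> R) :
  \big[op/idx]_(p | (p != i) && (p != j) && P p) F p
  = \big[op/idx]_(q | P (omit_index i j q)) F (omit_index i j q).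
Proof.
pose preim p := [pick q | omit_index i j q == p].
have omitK q : preim (omit_index i j q) = Some q.
  rewrite /preim; case: pickP => [q' /eqP /omit_index_inj -> // | /(_ q)].
  by rewrite eqxx.
rewrite (reindex_omap (omit_index i j) preim) => [|p] /=.
  by apply: eq_bigl => q; rewrite omit_index_neq omitK eqxx andbT.
case/andP=> /andP[neq_pi neq_pj] _.
by have [q <-] := omit_index_surj neq_pi neq_pj; rewrite omitK.
Qed.

Lemma sum_neq2 (F : 'I_n -> nat) :
  (\sum_(l | (l != i) && (l != j)) F l
   = \sum_(l < n | (l < i)%N) F l + \sum_(l < n | (i < l < j)%N) F l
     + \sum_(l < n | (j < l)%N) F l)%N.
Proof.
rewrite [LHS]big_mkcond [X in (X + _ + _)%N]big_mkcond.
rewrite [X in (_ + X + _)%N]big_mkcond [X in (_ + _ + X)%N]big_mkcond /=.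
rewrite -!big_split /=; apply: eq_bigr => l _; rewrite -!val_eqE /=.
by case: (ltngtP l i); case: (ltngtP l j) => /=; lia.
Qed.

Lemma sum_lt_neq2 (F : 'I_n -> nat) (p : 'I_n) :
  (\sum_(l < n | (l < p)%N) F l
   = \sum_(l | (l != i) && (l != j) && (l < p)%N) F l
     + (i < p)%N * F i + (j < p)%N * F j)%N.
Proof.
have neq_ji : j != i by rewrite -val_eqE /= gtn_eqF.
rewrite big_mkcond (bigD1 i) //= (bigD1 j) //= [X in (_ = X + _ + _)%N]big_mkcondr /=.
by case: (i < p)%N; case: (j < p)%N; lia.
Qed.

Lemma sum_lt_omit (F : 'I_n -> nat) (q : 'I_(n - 2)) :
  (\sum_(l | (l != i) && (l != j) && (l < omit_index i j q)%N) F l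
   = \sum_(l < n - 2 | (l < q)%N) F (omit_index i j l))%N.
Proof. by rewrite reindex_omit; apply: eq_bigl => l; rewrite omit_index_mono. Qed.

Variables (d : {ffun 'I_n -> 'Z_2}) (e : 'Z_2).

(** The Leibniz sign accounts for the degrees before i, and the change of gamma
    for those after i except j; they combine into the total degree of the
    arguments of the form, which is even whenever the form does not vanish. *)
Lemma sign_at_first :
  odd (e * \sum_(l < n | (l < i)%N) d l + gamma (shift_degree e i d) i j)%N
  = odd (gamma d i j + e * \sum_(l | (l != i) && (l != j)) d l)%N.
Proof.
have neq_ji : (j == i) = false by rewrite -val_eqE /= gtn_eqF.
have nlt_ji : (j < i)%N = false by rewrite ltnNge ltnW.
rewrite sum_neq2 [LHS]oddD odd_gamma_shift eqxx neq_ji nlt_ji ltnn /=.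
rewrite /gamma !(oddD, oddM).
by case: (odd e); case: (odd (d i)); case: (odd (d j));
  do 3![case: (odd (\sum_(_ < _ | _) _)%N)].
Qed.

(** As for the first position, except that the Leibniz sign also counts d_i:
    this is the sign with which D passes x_i in D [x_i, x_j]. *)
Lemma sign_at_second :
  odd (e * \sum_(l < n | (l < j)%N) d l + gamma (shift_degree e j d) i j)%N
  = odd (gamma d i j + e * \sum_(l | (l != i) && (l != j)) d l + e * d i)%N.
Proof.
have neq_ij : (i == j) = false by rewrite -val_eqE /= ltn_eqF.
have -> : (\sum_(l < n | (l < j)%N) d l
   = \sum_(l < n | (l < i)%N) d l + \sum_(l < n | (i < l < j)%N) d l + d i)%N.
  rewrite [LHS]big_mkcond [X in (X + _ + _)%N]big_mkcond.
  rewrite [X in (_ + X + _)%N]big_mkcond /= -big_split /=.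
  rewrite [RHS]addnC (bigD1 i) //= [in RHS](bigD1 i) //= lt_ij ltnn /= addn0.
  congr (_ + _)%N; apply: eq_bigr => l; rewrite -val_eqE /=.
  by case: (ltngtP l i); case: (ltngtP l j) => /=; lia.
rewrite sum_neq2 [LHS]oddD odd_gamma_shift eqxx neq_ij ltnn andbF /=.
rewrite /gamma !(oddD, oddM).
by case: (odd e); case: (odd (d i)); case: (odd (d j));
  do 3![case: (odd (\sum_(_ < _ | _) _)%N)].
Qed.

(** The Leibniz sign of position p counts d_i and d_j as soon as p is beyond i,
    respectively j; the change of gamma removes them again, because D x_p is
    moved across the same x_i and x_j. *)
Lemma sign_at_other p : p != i -> p != j ->
  odd (e * \sum_(l < n | (l < p)%N) d l + gamma (shift_degree e p d) i j)%N
  = odd (gamma d i j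
         + e * \sum_(l | (l != i) && (l != j) && (l < p)%N) d l)%N.
Proof.
rewrite ![p == _]eq_sym => /negPf neq_ip /negPf neq_jp.
(* As p differs from j, the position of p relative to i and j is encoded by
   i < p and i < p < j, the second implying the first; what is left is an
   identity between Booleans. *)
have lt_jp : (j < p)%N = (i < p)%N && ~~ (i < p < j)%N.
  have [lt_jp|lt_pj|/val_inj eq_jp] := ltngtP j p.
  - by rewrite andbF (ltn_trans lt_ij lt_jp).
  - by rewrite andbT andbN.
  - by rewrite eq_jp eqxx in neq_jp.
have lt_ip : (i < p < j)%N -> (i < p)%N by case/andP.
rewrite sum_lt_neq2 [LHS]oddD odd_gamma_shift neq_ip neq_jp lt_jp.
move: lt_ip; rewrite /gamma !(oddD, oddM) !oddb.
move: (i < p)%N (i < p < j)%N (odd e) (odd (d i)) (odd (d j)).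
move: (odd (\sum_(l < n | (j < l)%N) d l)%N).
move: (odd (\sum_(l < n | (i < l < j)%N) d l)%N).
move: (odd (\sum_(l | (l != i) && (l != j) && (l < p)%N) d l)%N).
by do 8!case=> //; move=> /(_ isT).
Qed.

Lemma sign_at_omit q (p := omit_index i j q) :
  odd (e * \sum_(l < n | (l < p)%N) d l + gamma (shift_degree e p d) i j)%N
  = odd (gamma d i j + e * \sum_(l < n - 2 | (l < q)%N) d (omit_index i j l))%N.
Proof.
have /andP[neq_pi neq_pj] := omit_index_neq q.
by rewrite sign_at_other // (sum_lt_omit (fun l => d l)).
Qed.

End Omit.

(** * Forms and products on homogeneous tuples *)

Section Forms.
Variables (K : fieldType) (V : lmodType K) (gr : z2grading V).

(** The projections of a grading are only assumed to give some decomposition;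
    directness of the sum forces it to be the homogeneous one. *)
Lemma proj_homog (a b : 'Z_2) v :
  v \in part gr a -> proj gr b v = if b == a then v else 0.
Proof.
have swap (u w : V) c : u + w \in part gr c -> u \in part gr c ->
    w \in part gr c.
  move=> uw_c u_c; have -> : w = u + w - u by rewrite addrAC subrr add0r.
  by rewrite -[X in _ + X]scaleN1r rpredD ?rpredZ.
have Z2P (c : 'Z_2) : c = 0 \/ c = 1.
  by case: c => [[|[|]]] // lt_c; [left | right]; apply: val_inj.
move=> v_a; have def_v := proj_sum gr v.
have v0 := proj_part gr 0 v; have v1 := proj_part gr 1 v.
case: (Z2P a) => def_a; rewrite def_a in v_a *.
  have v1_0 : proj gr 1 v = 0.
    by apply: part_direct v1; apply: swap v0; rewrite -def_v.
  by case: (Z2P b) => ->; rewrite ?v1_0 // {2}def_v v1_0 addr0.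
have v0_0 : proj gr 0 v = 0.
  by apply: (part_direct v0); apply: swap v1; rewrite addrC -def_v.
by case: (Z2P b) => ->; rewrite ?v0_0 // {2}def_v v0_0 add0r.
Qed.

Lemma multilinear_eq0 m (phi : {ffun 'I_m -> V} -> K^o)
    (x : {ffun 'I_m -> V}) i :
  multilinear phi -> x i = 0 -> phi x = 0.
Proof.
move=> lin_phi xi0; have := lin_phi i x (-1) 0 0.
set y := finfun _; have -> : y = x.
  by apply/ffunP=> l; rewrite ffunE; case: eqP => [->|]; rewrite ?xi0 ?scaler0 ?addr0.
set z := finfun _; have -> : z = x.
  by apply/ffunP=> l; rewrite ffunE; case: eqP => [->|].
by rewrite scaleN1r addNr.
Qed.

Lemma even_form_odd m (phi : {ffun 'I_m -> V} -> K^o) d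
    (x : {ffun 'I_m -> V}) :
  even_form gr phi -> homogeneous_tuple gr d x -> odd (\sum_i d i)%N ->
  phi x = 0.
Proof.
move=> even_phi hom_x odd_d; apply: even_phi hom_x _.
by apply: contraL odd_d => /eqP sum0; rewrite -odd_sum_Z2 sum0.
Qed.

Lemma iter_even_map (alpha : V -> V) k : even_map gr alpha ->
  even_map gr (iter k alpha).
Proof.
move=> even_alpha a v v_a; rewrite add0r.
by elim: k => //= k /even_alpha; rewrite add0r.
Qed.

Section TwistInvariance.
Variables (m : nat) (phi : {ffun 'I_m -> V} -> K^o) (alpha : V -> V).
Hypothesis skew_phi : super_skew gr phi.
Hypothesis even_alpha : even_map gr alpha.
Hypothesis phi_alpha : forall x : {ffun 'I_m -> V},
  phi [ffun l => if val l == 0%N then alpha (x l) else x l] = phi x.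

(** The first position is the assumption on the form.  To pass from position i
    to i + 1, exchange these two arguments: since alpha preserves degrees, the
    sign is the same with and without alpha, and cancels. *)
Lemma form_twist_at (i : 'I_m) d (x : {ffun 'I_m -> V}) :
  homogeneous_tuple gr d x ->
  phi [ffun l => if l == i then alpha (x l) else x l] = phi x.
Proof.
case: i => i lt_im; elim: i lt_im d x => [|i IHi] lt_im d x hom_x.
  by rewrite -[RHS]phi_alpha; congr phi; apply/ffunP=> l; rewrite !ffunE.
pose j := Ordinal lt_im; pose i' := Ordinal (ltnW lt_im).
pose x' := [ffun l => if l == j then alpha (x l) else x l].
have hom_x' : homogeneous_tuple gr d x'.
  move=> l; rewrite ffunE; case: ifP => // _.
  by have := even_alpha (hom_x l); rewrite add0r.
pose y := [ffun l => x (tperm i' j l)].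
have hom_y : homogeneous_tuple gr [ffun l => d (tperm i' j l)] y.
  by move=> l; rewrite !ffunE.
have swap z := skew_phi (i := i') (j := j) (d := d) (x := z) erefl.
have twist_y := IHi (ltnW lt_im) _ y hom_y; rewrite swap // in twist_y.
apply: (mulfI (x := - (-1) ^+ (d i' * d j)%N)); first by rewrite oppr_eq0 signr_eq0.
rewrite -twist_y -[LHS]swap //; congr phi; apply/ffunP=> l; rewrite !ffunE.
by rewrite -/j -/i' -[X in _ == X](tpermL i' j) (inj_eq perm_inj).
Qed.

(** The exponent may depend on the position, so that one can remove the twists
    around an argument D x_p that carries none. *)
Lemma form_twist (kappa : 'I_m -> nat) d (x : {ffun 'I_m -> V}) :
  homogeneous_tuple gr d x ->
  phi [ffun l => iter (kappa l) alpha (x l)] = phi x.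
Proof.
move=> hom_x; have [s] := ubnP (\sum_l kappa l)%N.
elim: s kappa => // s IHs kappa le_s.
have [/existsP[i kappa_i]|/existsPn kappa0] :=
  boolP [exists i, (0 < kappa i)%N]; last first.
  congr phi; apply/ffunP=> l; rewrite ffunE.
  by have := kappa0 l; rewrite -eqn0Ngt => /eqP ->.
pose kappa' l := if l == i then (kappa l).-1 else kappa l.
have hom_y : homogeneous_tuple gr d [ffun l => iter (kappa' l) alpha (x l)].
  move=> l; rewrite ffunE.
  by have := iter_even_map (kappa' l) even_alpha (hom_x l); rewrite add0r.
rewrite -(IHs kappa').
  rewrite -(form_twist_at i hom_y); congr phi; apply/ffunP=> l; rewrite !ffunE.
  by rewrite /kappa'; case: eqP => // ->; rewrite -iterS prednK.
rewrite ltnS in le_s; apply: leq_trans le_s; rewrite [X in (_ < X)%N](bigD1 i) //=.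
rewrite (bigD1 i) //= /kappa' eqxx -addSn prednK // leq_add2l.
by apply: leq_sum => l /negPf ->.
Qed.

End TwistInvariance.

Section Product.
Variables (n : nat) (br : {bilinear V -> V -> V}).
Variable phi : {ffun 'I_(n - 2) -> V} -> K^o.

Lemma nary_product_homog_eq0 d (x : {ffun 'I_n -> V}) p :
  multilinear phi -> x p = 0 -> nary_product_homog br phi d x = 0.
Proof.
move=> lin_phi xp0; apply: big1 => i _; apply: big1 => j lt_ij.
have [<-|neq_pi] := eqVneq p i; first by rewrite xp0 linear0l scaler0.
have [<-|neq_pj] := eqVneq p j; first by rewrite xp0 linear0r scaler0.
have [q def_p] := omit_index_surj lt_ij neq_pi neq_pj.
by rewrite (multilinear_eq0 (i := q)) ?mulr0 ?scale0r // ffunE def_p.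
Qed.

(** Every summand of the multilinear extension other than that of the degrees
    of x has a vanishing argument. *)
Lemma nary_product_homogE d (x : {ffun 'I_n -> V}) :
  multilinear phi -> homogeneous_tuple gr d x ->
  nary_product gr br phi x = nary_product_homog br phi d x.
Proof.
move=> lin_phi hom_x; rewrite /nary_product (bigD1 d) //= big1 ?addr0.
  congr nary_product_homog; apply/ffunP=> l.
  by rewrite ffunE (proj_homog _ (hom_x l)) eqxx.
move=> d' neq_d'd; have [p neq_p] : exists p, d' p != d p.
  apply/existsP; apply: contraR neq_d'd => /existsPn eq_d'd.
  by apply/eqP/ffunP=> l; apply/eqP; have := eq_d'd l; rewrite negbK.
apply: (nary_product_homog_eq0 _ (p := p)) => //.
by rewrite ffunE (proj_homog _ (hom_x p)) (negPf neq_p).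
Qed.

End Product.

Lemma binary_derivation (br : {bilinear V -> V -> V})
    (alpha D : {linear V -> V}) k e a b x y :
  alpha_derivation gr (binary br) alpha k e D ->
  x \in part gr a -> y \in part gr b ->
  D (br x y) = br (D x) (iter k alpha y)
               + (-1) ^+ (e * a)%N *: br (iter k alpha x) (D y).
Proof.
move=> [_ _ leibniz] x_a y_b.
pose z := [ffun l : 'I_2 => if l == ord0 then x else y].
pose d := [ffun l : 'I_2 => if l == ord0 then a else b].
have hom_z : homogeneous_tuple gr d z by move=> l; rewrite !ffunE; case: ifP.
have := leibniz d z hom_z.
rewrite big_ord_recl big_ord1 /binary !ffunE /= => ->.
rewrite big_pred0 // muln0 scale1r; congr (_ + _ *: _).
by rewrite big_mkcond big_ord_recl big_ord1 /= !ffunE /= addn0.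
Qed.

(** * The Leibniz rule *)

Section Leibniz.
Variables (br : {bilinear V -> V -> V}) (alpha D : {linear V -> V}).
Variables (n k : nat) (e : 'Z_2) (phi : {ffun 'I_(n - 2) -> V} -> K^o).
Hypothesis even_alpha : even_map gr alpha.
Hypotheses (phi_wedge : wedge_form gr phi) (phi_even : even_form gr phi).
Hypothesis phi_alpha : forall x : {ffun 'I_(n - 2) -> V},
  phi [ffun l => if val l == 0%N then alpha (x l) else x l] = phi x.
Hypothesis D_der : alpha_derivation gr (binary br) alpha k e D.
Hypothesis D_phi : forall d (x : {ffun 'I_(n - 2) -> V}),
  homogeneous_tuple gr d x ->
  \sum_(i < n - 2) (-1) ^+ (e * \sum_(l < n - 2 | (l < i)%N) d l)%N
    * phi [ffun l => if l == i then D (x l) else x l] = 0.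

Variables (d : {ffun 'I_n -> 'Z_2}) (x : {ffun 'I_n -> V}).
Hypothesis hom_x : homogeneous_tuple gr d x.

Definition leibniz_args (p : 'I_n) : {ffun 'I_n -> V} :=
  [ffun l => if l == p then D (x l) else iter k alpha (x l)].

Lemma leibniz_args_homog p :
  homogeneous_tuple gr (shift_degree e p d) (leibniz_args p).
Proof.
have [D_homog _ _] := D_der; move=> l; rewrite !ffunE; case: eqP => _.
  exact: D_homog.
by have := iter_even_map k even_alpha (hom_x l); rewrite add0r.
Qed.

Lemma omit_homog i j :
  homogeneous_tuple gr [ffun l => d (omit_index i j l)] (omit i j x).
Proof. by move=> l; rewrite !ffunE. Qed.

Section Pair.
Variables (i j : 'I_n).
Hypothesis lt_ij : (i < j)%N.

Lemma form_leibniz_args_in p : (p == i) || (p == j) ->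
  phi (omit i j (leibniz_args p)) = phi (omit i j x).
Proof.
move=> p_ij; have [_ skew_phi] := phi_wedge.
rewrite -(form_twist skew_phi even_alpha phi_alpha (fun=> k) (omit_homog i j)).
congr phi; apply/ffunP=> l; rewrite !ffunE.
have /andP[neq_i neq_j] := omit_index_neq lt_ij l.
by case: eqP => // eq_p; rewrite -eq_p (negPf neq_i) (negPf neq_j) in p_ij.
Qed.

Lemma form_leibniz_args_omit q :
  phi (omit i j (leibniz_args (omit_index i j q)))
  = phi [ffun l => if l == q then D (omit i j x l) else omit i j x l].
Proof.
have [_ skew_phi] := phi_wedge; have [D_homog _ _] := D_der.
set z := finfun (fun l => if l == q then _ else _).
have hom_z : homogeneous_tuple gr
    (shift_degree e q [ffun l => d (omit_index i j l)]) z.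
  by move=> l; rewrite !ffunE; case: ifP => // _; apply: D_homog.
rewrite -(form_twist skew_phi even_alpha phi_alpha
            (fun l => if l == q then 0%N else k) hom_z).
congr phi; apply/ffunP=> l; rewrite !ffunE (inj_eq (omit_index_inj lt_ij)).
by case: ifP.
Qed.

(** This is where evenness of the form enters: if the omitted tuple has odd
    total degree, both sides are 0. *)
Lemma sign_form_omit :
  (-1) ^+ (e * \sum_(l | (l != i) && (l != j)) d l)%N * phi (omit i j x)
  = phi (omit i j x).
Proof.
have sum_omit : (\sum_(l | (l != i) && (l != j)) d l
                 = \sum_l [ffun l => d (omit_index i j l)] l)%N.
  under eq_bigl do rewrite -[_ && _]andbT.
  by rewrite (reindex_omit lt_ij _ xpredT); apply: eq_bigr => l _; rewrite ffunE.
have [odd_d|even_d] := boolP (odd (\sum_(l | (l != i) && (l != j)) d l)%N).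
  rewrite (even_form_odd phi_even (omit_homog i j)) ?mulr0 //.
  by rewrite -sum_omit.
by rewrite -signr_odd oddM (negPf even_d) andbF mul1r.
Qed.

(** The sign of the Leibniz rule is included, so that for a fixed pair (i, j)
    the terms of all positions p can be added up. *)
Definition leibniz_coef (p : 'I_n) : K :=
  (-1) ^+ (e * \sum_(l < n | (l < p)%N) d l)%N
  * ((-1) ^+ (i + j + 1)%N * (-1) ^+ gamma (shift_degree e p d) i j
     * phi (omit i j (leibniz_args p))).

Definition product_coef : K :=
  (-1) ^+ (i + j + 1)%N * (-1) ^+ gamma d i j * phi (omit i j x).

Lemma leibniz_coefE p : leibniz_coef p =
  (-1) ^+ (i + j + 1)%N
  * ((-1) ^+ (e * \sum_(l < n | (l < p)%N) d l
              + gamma (shift_degree e p d) i j)%N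
     * phi (omit i j (leibniz_args p))).
Proof. by rewrite /leibniz_coef [X in _ = _ * (X * _)]exprD -!mulrA mulrCA. Qed.

Lemma leibniz_coef_first : leibniz_coef i = product_coef.
Proof.
rewrite leibniz_coefE (eq_signr K (sign_at_first lt_ij d e)).
rewrite form_leibniz_args_in ?eqxx // [X in _ * (X * _)]exprD -[X in _ * X]mulrA.
by rewrite sign_form_omit mulrA.
Qed.

Lemma leibniz_coef_second :
  leibniz_coef j = product_coef * (-1) ^+ (e * d i)%N.
Proof.
rewrite leibniz_coefE (eq_signr K (sign_at_second lt_ij d e)).
rewrite form_leibniz_args_in ?eqxx ?orbT //.
rewrite [X in _ * (X * _)]exprD [X in _ * (X * _)]mulrC -[X in _ * X]mulrA.
rewrite [X in _ * (_ * (X * _))]exprD -[X in _ * (_ * X)]mulrA sign_form_omit.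
by rewrite mulrCA mulrC mulrA.
Qed.

(** All the terms share the sign of gamma at the original degrees, and what
    remains is the sum that the assumption on D sends to 0. *)
Lemma leibniz_coef_omit :
  \sum_(p | (p != i) && (p != j)) leibniz_coef p = 0.
Proof.
under eq_bigl do rewrite -[_ && _]andbT.
rewrite (reindex_omit lt_ij _ xpredT) /=.
under eq_bigr => q _.
  rewrite leibniz_coefE (eq_signr K (sign_at_omit lt_ij d e q)).
  rewrite form_leibniz_args_omit [X in _ * (X * _)]exprD -[X in _ * X]mulrA mulrA.
  over.
rewrite -mulr_sumr; apply/eqP; rewrite mulf_eq0; apply/orP; right; apply/eqP.
rewrite -[RHS](D_phi (omit_homog i j)); apply: eq_bigr => q _.
by congr ((-1) ^+ (e * _) * _); apply: eq_bigr => l _; rewrite ffunE.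
Qed.

Lemma leibniz_pair :
  \sum_p leibniz_coef p *: br (leibniz_args p i) (leibniz_args p j)
  = product_coef *: D (br (x i) (x j)).
Proof.
have neq_ji : j != i by rewrite -val_eqE /= gtn_eqF.
rewrite (bigD1 i) //= (bigD1 j) //= !ffunE !eqxx [i == j]eq_sym (negPf neq_ji).
under eq_bigr => p /andP[neq_pi neq_pj].
  rewrite !ffunE ![_ == p]eq_sym (negPf neq_pi) (negPf neq_pj); over.
rewrite -scaler_suml leibniz_coef_omit scale0r addr0.
rewrite leibniz_coef_first leibniz_coef_second.
by rewrite (binary_derivation D_der (hom_x i) (hom_x j)) scalerDr scalerA.
Qed.

End Pair.

Lemma nary_product_leibniz :
  D (nary_product_homog br phi d x)
  = \sum_(p < n) (-1) ^+ (e * \sum_(l < n | (l < p)%N) d l)%N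
      *: nary_product_homog br phi (shift_degree e p d) (leibniz_args p).
Proof.
rewrite /nary_product_homog linear_sum.
under [RHS]eq_bigr do rewrite scaler_sumr.
rewrite exchange_big; apply: eq_bigr => i _ /=; rewrite linear_sum.
under [RHS]eq_bigr do rewrite scaler_sumr.
rewrite exchange_big; apply: eq_bigr => j lt_ij /=.
rewrite linearZ /= -(leibniz_pair lt_ij).
by apply: eq_bigr => p _; rewrite scalerA.
Qed.

End Leibniz.
End Forms.

Theorem proposition2p7 (K : closedFieldType) (charK : [pchar K] =i pred0)
    (V : lmodType K) (gr : z2grading V)
    (br : {bilinear V -> V -> V}) (alpha : {linear V -> V})
    (hls : hom_lie_superalgebra gr br alpha) (mult : hom_multiplicative br alpha)
    (n : nat) (n_ge3 : (3 <= n)%N)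
    (phi : {ffun 'I_(n - 2) -> V} -> K^o)
    (phi_wedge : wedge_form gr phi) (phi_even : even_form gr phi)
    (phi_delta : forall dX (X : {ffun 'I_(n - 3) -> V}), homogeneous_tuple gr dX X ->
       forall d (y : {ffun 'I_n -> V}), homogeneous_tuple gr d y ->
         wedge_delta br phi X d y = 0)
    (phi_alpha : forall x : {ffun 'I_(n - 2) -> V},
       phi [ffun l => if val l == 0%N then alpha (x l) else x l] = phi x)
    (k : nat) (e : 'Z_2) (D : {linear V -> V})
    (D_der : alpha_derivation gr (binary br) alpha k e D)
    (D_phi : forall d (x : {ffun 'I_(n - 2) -> V}), homogeneous_tuple gr d x ->
       \sum_(i < n - 2) (-1) ^+ (e * \sum_(l < n - 2 | (l < i)%N) d l)%N
         * phi [ffun l => if l == i then D (x l) else x l] = 0) :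
  alpha_derivation gr (nary_product gr br phi) alpha k e D.
Proof.
have even_alpha := hls_even_twist hls; have [lin_phi _] := phi_wedge.
have [D_homog D_alpha _] := D_der; split=> // d x hom_x.
rewrite (nary_product_homogE _ lin_phi hom_x).
rewrite (nary_product_leibniz even_alpha phi_wedge phi_even phi_alpha D_der
           D_phi hom_x).
apply: eq_bigr => p _; congr (_ *: _); symmetry.
apply: nary_product_homogE => //.
exact: (leibniz_args_homog even_alpha D_der hom_x).
Qed.
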